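(* Let $A$ be a topologically nilpotent Banach algebra, and let $\phi\colon Y\to X$ be a morphism of left Banach $A$-modules such that $X=\operatorname{Im}\phi+\operatorname{Im}\pi^A_X$. Then $\phi$ is surjective.
   Context: Banach algebras are over $\mathbb{C}$, are not assumed unital here, and their multiplication has norm at most $1$, i.e. $\|ab\|\le\|a\|\|b\|$. A left Banach $A$-module is a Banach space $X$ with a left $A$-module structure such that $\|a\cdot x\|\le \|a\|\|x\|$. A morphism of Banach modules is a bounded $A$-linear map. For $n\in\mathbb{N}$ set $S(n):=\sup\|r_1r_2\cdots r_n\|^{1/n}$, where $r_1,\dots,r_n$ run over the unit ball of $A$. The algebra $A$ is called topologically nilpotent if $\lim_{n\to\infty}S(n)=0$. $\widehat{\otimes}$ denotes the projective tensor product of Banach spaces, and $\pi^A_X\colon A\widehat{\otimes}X\to X$ is the morphism determined by $r\otimes x\mapsto r\cdot x$. *)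

(* Defs.v *)
From HB Require Import structures.
From mathcomp Require Import all_boot all_order all_algebra.
From mathcomp Require Import sesquilinear.
From mathcomp Require Import complex.
From mathcomp Require Import all_classical all_reals all_analysis.

Set Implicit Arguments.
Unset Strict Implicit.
Unset Printing Implicit Defensive.

Import Order.TTheory GRing.Theory Num.Theory.
Import numFieldNormedType.Exports.

Local Open Scope ring_scope.
Local Open Scope complex_scope.
Local Open Scope classical_set_scope.

(* The MathComp ring structures are unital, so the multiplication of a Banach
   algebra is a bilinear map on a Banach space. *)
HB.mixin Record CompleteNormedModule_isBanachAlgebra (K : numFieldType) (A : Type)
    of CompleteNormedModule K A := {
  bmul : {bilinear A -> A -> A};
  bmulA : forall a b c : A, bmul a (bmul b c) = bmul (bmul a b) c;
  normr_bmul : forall a b : A, `|bmul a b| <= `|a| * `|b|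
}.

#[short(type="banachAlgType")]
HB.structure Definition BanachAlgebra (K : numFieldType) :=
  { A of CompleteNormedModule_isBanachAlgebra K A & CompleteNormedModule K A }.

HB.mixin Record CompleteNormedModule_isBanachModule (K : numFieldType)
    (A : banachAlgType K) (X : Type) of CompleteNormedModule K X := {
  bact : {bilinear A -> X -> X};
  bactA : forall (a b : A) (x : X), bact a (bact b x) = bact (bmul a b) x;
  normr_bact : forall (a : A) (x : X), `|bact a x| <= `|a| * `|x|
}.

#[short(type="banachModType")]
HB.structure Definition BanachModule (K : numFieldType) (A : banachAlgType K) :=
  { X of CompleteNormedModule_isBanachModule K A X & CompleteNormedModule K X }.

Definition bounded_linear (K : numFieldType) (E F : normedModType K)
    (f : {linear E -> F}) : Prop :=
  exists M : K, forall x : E, `|f x| <= M * `|x|.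

Definition banach_module_morphism (K : numFieldType) (A : banachAlgType K)
    (Y X : banachModType A) (f : {linear Y -> X}) : Prop :=
  bounded_linear f /\ forall (a : A) (y : Y), f (bact a y) = bact a (f y).

(* The product r_1 r_2 ... r_n; the empty product, meaningless in an algebra
   without unit, gets the dummy value 0. *)
Definition bprod (K : numFieldType) (A : banachAlgType K) (s : seq A) : A :=
  if s is r :: s' then foldl (fun a b => bmul a b) r s' else 0.

(* The norm of a normed space over R[i] takes its values in R[i], hence the real
   part below. The value at n = 0 is irrelevant. *)
Definition nilpotency_radius (R : realType) (A : banachAlgType R[i]) (n : nat) : R :=
  sup [set (complex.Re `|bprod r|) `^ (n%:R^-1) |
        r in [set r : n.-tuple A | forall a, a \in tval r -> `|a| <= 1]].

Definition topologically_nilpotent (R : realType) (A : banachAlgType R[i]) : Prop :=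
  nilpotency_radius A n @[n --> \oo] --> (0 : R).

(* The projective tensor product of Banach spaces E and F, given up to isometric
   isomorphism by its universal property: every bounded bilinear map on E x F
   factors through t as a unique bounded linear map, with the same norm. *)
Record is_projective_tensor (K : numFieldType) (E F T : completeNormedModType K)
    (t : {bilinear E -> F -> T}) : Prop := IsProjectiveTensor {
  ptensor_norm : forall e f, `|t e f| <= `|e| * `|f|;
  ptensor_lift : forall (Z : completeNormedModType K) (B : {bilinear E -> F -> Z})
      (M : K), 0 <= M -> (forall e f, `|B e f| <= M * (`|e| * `|f|)) ->
    exists2 g : {linear T -> Z}, (forall e f, g (t e f) = B e f) &
      forall u, `|g u| <= M * `|u|;
  ptensor_unique : forall (Z : completeNormedModType K) (g h : {linear T -> Z}),
    bounded_linear g -> bounded_linear h ->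
    (forall e f, g (t e f) = h (t e f)) -> forall u, g u = h u
}.

(* The morphism [r (x) x |-> r . x], determined among bounded linear maps by its
   values on elementary tensors. *)
Definition is_action_map (K : numFieldType) (A : banachAlgType K)
    (X : banachModType A) (T : completeNormedModType K) (t : {bilinear A -> X -> T})
    (p : {linear T -> X}) : Prop :=
  bounded_linear p /\ forall (r : A) (x : X), p (t r x) = bact r x.

(* Main.v *)
(* The map (y, u) |-> phi y + piX u is onto, so by the Baire category argument
   of the open mapping theorem every x is approximated, to any relative
   precision, by phi y + piX u with |y|, |u| <= C |x|; and piX u is approximated
   by finite sums of a_i . x_i with \sum |a_i| |x_i| about |u|.  Applying this
   again to the x_i and iterating, x is approximated by phi y + h, where
   |y| <= K_n |x| and h is a finite sum of (a_1 ... a_n) . x_i with |a_j| <= 1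
   and \sum |x_i| <= C^n |x|.  Then |h| <= (S(n) C)^n |x|, which for large n is
   at most |x| / 4, so phi is surjective up to an error |x| / 2 and a geometric
   series makes it surjective. *)
Require Import Defs.
From HB Require Import structures.
From mathcomp Require Import all_boot all_order all_algebra.
From mathcomp Require Import sesquilinear.
From mathcomp Require Import complex.
From mathcomp Require Import all_classical all_reals all_analysis.
From mathcomp Require Import lra ring.
Import Order.TTheory GRing.Theory Num.Theory.
Import numFieldNormedType.Exports.
Local Open Scope ring_scope.
Local Open Scope complex_scope.
Local Open Scope classical_set_scope.

(** * Real-valued norms on complex normed spaces *)

(** Moves norms from [R[i]], which is only partially ordered, to [R], where infima and [lra]
    apply. *)
Definition rnorm {R : realType} {V : normedModType R[i]} (x : V) : R :=
  complex.Re `|x|.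

Section RealNorm.
Context {R : realType} {V : normedModType R[i]}.
Implicit Types (x y : V) (r : R).

Lemma normr_rnorm x : `|x| = (rnorm x)%:C.
Proof. by rewrite /rnorm RRe_real ?normr_real. Qed.

Lemma rnorm_ge0 x : 0 <= rnorm x.
Proof. by rewrite -ler0c -normr_rnorm normr_ge0. Qed.

Lemma rnorm0 : rnorm (0 : V) = 0.
Proof. by rewrite /rnorm normr0. Qed.

Lemma rnorm_eq0 x : rnorm x = 0 -> x = 0.
Proof. by move=> x0; apply/normr0_eq0; rewrite normr_rnorm x0. Qed.

Lemma rnorm_gt0 x : x != 0 -> 0 < rnorm x.
Proof. by move=> x0; rewrite -ltcR -normr_rnorm normr_gt0. Qed.

Lemma rnormN x : rnorm (- x) = rnorm x.
Proof. by rewrite /rnorm normrN. Qed.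

Lemma rnormB x y : rnorm (x - y) = rnorm (y - x).
Proof. by rewrite -rnormN opprB. Qed.

Lemma ler_rnormD x y : rnorm (x + y) <= rnorm x + rnorm y.
Proof. by rewrite -lecR rmorphD/= -!normr_rnorm ler_normD. Qed.

Lemma ler_rnorm_dist x y z : rnorm (x - z) <= rnorm (x - y) + rnorm (y - z).
Proof. by rewrite (le_trans _ (ler_rnormD _ _))// addrA subrK. Qed.

Lemma rnormZ (l : R[i]) x : rnorm (l *: x) = complex.Re `|l| * rnorm x.
Proof.
apply/complexI; rewrite -normr_rnorm normrZ normr_rnorm rmorphM/=.
by rewrite RRe_real ?normr_real.
Qed.

Lemma rnormZr r x : 0 <= r -> rnorm (r%:C *: x) = r * rnorm x.
Proof. by move=> r0; rewrite rnormZ ger0_norm ?ler0c. Qed.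

End RealNorm.

Lemma Re_normr_ge0 {R : realType} (l : R[i]) : 0 <= complex.Re `|l|.
Proof. by rewrite -ler0c RRe_real ?normr_real. Qed.

Lemma cvg_rnorm (R : realType) (V : normedModType R[i]) (F : set_system V)
    (FF : Filter F) (x : V) :
  F --> x <-> forall e : R, 0 < e -> \forall y \near F, rnorm (x - y) < e.
Proof.
split=> [/fcvgrPdist_lt cF e e0|cF].
  have := cF e%:C; rewrite ltcR => /(_ e0).
  by apply: filterS => y; rewrite normr_rnorm ltcR.
apply/fcvgrPdist_lt => e e0.
have eR : (complex.Re e)%:C = e by rewrite RRe_real ?gtr0_real.
rewrite -eR ltcR in e0; apply: filterS (cF _ e0) => y.
by rewrite -[e]eR normr_rnorm ltcR.
Qed.

Lemma cauchy_rnorm (R : realType) (V : normedModType R[i]) (F : set_system V)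
    (FF : ProperFilter F) :
  cauchy F <->
    forall e : R, 0 < e -> exists x, \forall y \near F, rnorm (x - y) < e.
Proof.
split=> [/cauchyP cF e e0|cF].
  have := cF e%:C; rewrite ltcR => /(_ e0)[x Fx]; exists x.
  by apply: filterS Fx => y; rewrite -ball_normE /= normr_rnorm ltcR.
apply/cauchyP => e e0.
have eR : (complex.Re e)%:C = e by rewrite RRe_real ?gtr0_real.
rewrite -eR ltcR in e0; have [x Fx] := cF _ e0; exists x.
by apply: filterS Fx => y; rewrite -[e]eR -ball_normE /= normr_rnorm ltcR.
Qed.

(** * Equivalent norms and completeness *)

Record equiv_norm {R : realType} (V : normedModType R[i]) := EquivNorm {
  enorm :> V -> R;
  enormD : forall x y, enorm (x + y) <= enorm x + enorm y;
  enormZ : forall (l : R[i]) x, enorm (l *: x) = complex.Re `|l| * enorm x;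
  rnorm_le_enorm : exists2 c, 0 < c & forall x, rnorm x <= c * enorm x;
  enorm_le_rnorm : exists2 c, 0 < c & forall x, enorm x <= c * rnorm x
}.

(* [N] is a phantom parameter, to which the normed structure is attached. *)
Definition renormed {R : realType} {V : normedModType R[i]}
  (N : equiv_norm V) : Type := V.

Section Renormed.
Variables (R : realType) (V : completeNormedModType R[i]) (N : equiv_norm V).

HB.instance Definition _ := GRing.Lmodule.on (renormed N).

Let norm (x : renormed N) : R[i] := (N x)%:C.

Let normD x y : norm (x + y) <= norm x + norm y.
Proof. by rewrite -rmorphD lecR enormD. Qed.

Let normZ l x : norm (l *: x) = `|l| * norm x.
Proof.
by rewrite /norm enormZ rmorphM/=; congr (_ * _); rewrite RRe_real ?normr_real.
Qed.

Let norm_eq0 x : norm x = 0 -> x = 0.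
Proof.
move=> /complexI N0; have [c _ /(_ x)] := rnorm_le_enorm _ N.
rewrite N0 mulr0 => cx; apply: rnorm_eq0; apply/eqP.
by rewrite eq_le cx rnorm_ge0.
Qed.

HB.instance Definition _ :=
  Lmodule_isNormed.Build R[i] (renormed N) normD normZ norm_eq0.

Lemma rnorm_renormed (x : renormed N) : rnorm x = N x.
Proof. by []. Qed.

Let complete (F : set_system (renormed N)) :
  ProperFilter F -> cauchy F -> cvg F.
Proof.
move=> FF /cauchy_rnorm cF.
have [c c0 Nle] := rnorm_le_enorm _ N.
have [d d0 leN] := enorm_le_rnorm _ N.
(* Cauchy filters pass to the original norm through [c]; the limit comes back through [d]. *)
have : cauchy (F : set_system V).
  apply/cauchy_rnorm => e e0; have [|x Fx] := cF (e / c); first exact: divr_gt0.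
  exists x; apply: filterS Fx => y; rewrite rnorm_renormed ltr_pdivlMr// mulrC.
  exact: le_lt_trans.
move=> /cauchy_cvg/cvg_ex[l /cvg_rnorm Fl]; apply/cvg_ex; exists l.
apply/cvg_rnorm => e e0; have := Fl (e / d) (divr_gt0 e0 d0).
apply: filterS => y; rewrite rnorm_renormed ltr_pdivlMr// mulrC.
exact: le_lt_trans.
Qed.

HB.instance Definition _ := Uniform_isComplete.Build (renormed N) complete.

End Renormed.

(** * Convergence with a rate, and Baire category *)

(** The increments beyond index [n] telescope to at most [r n], so the potential [r] is also the
    error bound of the limit. *)
Lemma cvg_telescope {R : realType} {V : completeNormedModType R[i]}
    (u : nat -> V) (r : nat -> R) :
  (forall n, 0 <= r n) -> (forall e, 0 < e -> exists n, r n < e) ->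
  (forall n, rnorm (u n.+1 - u n) <= r n - r n.+1) ->
  exists l, forall n, rnorm (l - u n) <= r n.
Proof.
move=> r0 rlt ur.
have ler n k : rnorm (u n - u (n + k)%N) <= r n - r (n + k)%N.
  elim: k => [|k ih]; first by rewrite addn0 !subrr rnorm0.
  rewrite addnS (le_trans (ler_rnorm_dist _ (u (n + k)%N) _))//.
  by rewrite [X in _ + X]rnormB; have := ur (n + k)%N; lra.
have ltr n m : (n <= m)%N -> rnorm (u n - u m) <= r n.
  by move=> /subnKC <-; apply: le_trans (ler n _) _; rewrite gerBl.
have : cauchy (u @ \oo).
  apply/cauchy_rnorm => e e0; have [n rn] := rlt e e0.
  by exists (u n), n => // m /= nm; rewrite (le_lt_trans (ltr _ _ nm)).
move=> /cauchy_cvg/cvg_ex[l /cvg_rnorm ul]; exists l => n.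
apply/ler_addgt0Pr => e e0; have [m _ um] := ul e e0.
rewrite (le_trans (ler_rnorm_dist _ (u (maxn n m)) _))// addrC lerD//.
  by rewrite rnormB ltr// leq_maxl.
by apply/ltW/um; rewrite /= leq_maxr.
Qed.

Lemma halving_small {R : realType} (r : nat -> R) (e : R) :
  (forall n, r n.+1 <= r n / 2) -> 0 < e -> exists n, r n < e.
Proof.
move=> rle e0.
have rn n : r n <= r 0%N / 2 ^+ n.
  elim: n => [|n ih]; first by rewrite expr0 divr1.
  by rewrite (le_trans (rle n))// exprSr invfM mulrA ler_pM2r ?invr_gt0.
have /cvgr0Pnorm_lt/(_ e e0)[n _ /(_ n (leqnn n))] :
    geometric (r 0%N) (2^-1 : R) n @[n --> \oo] --> (0 : R).
  by apply: cvg_geometric; rewrite ger0_norm ?invr_ge0// invf_lt1 ?ltr1n.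
rewrite /= exprVn => nlt; exists n.
exact: le_lt_trans (rn n) (le_lt_trans (ler_norm _) nlt).
Qed.

(* The library's theorem Baire is restricted to real scalars. *)
Lemma baire_cover {R : realType} {V : completeNormedModType R[i]}
    (F : nat -> set V) : (forall x, exists n, F n x) ->
  exists n x0, exists2 r : R, 0 < r & forall x (e : R), rnorm (x - x0) < r ->
    0 < e -> exists2 z, F n z & rnorm (x - z) < e.
Proof.
move=> Fcov; apply: contrapT => nF.
(* The positivity premise stands inside the existential, so that [choice] gives a total function. *)
have step (nxr : nat * (V * R)) : exists yd : V * R, 0 < nxr.2.2 ->
    [/\ 0 < yd.2, yd.2 <= nxr.2.2 / 2,
        rnorm (yd.1 - nxr.2.1) <= nxr.2.2 / 2 &
        forall z, rnorm (yd.1 - z) <= yd.2 -> ~ F nxr.1 z].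
  case: nxr => n [x r] /=.
  have [r0|r0] := pselect (0 < r); last by exists (x, r).
  (* Without such a closed ball, [F n] would be dense in the ball of radius [r / 2] about [x]. *)
  apply: contrapT => nstep; apply: nF; exists n, x, (r / 2); first lra.
  move=> y e yx e0; apply: contrapT => nz; apply: nstep.
  (* No point of [F n] lies within [e] of [y], so the closed ball of radius [e / 2] misses [F n]. *)
  exists (y, Num.min (e / 2) (r / 2)) => _ /=; split.
  - by rewrite lt_min; lra.
  - by rewrite ge_min lexx orbT.
  - lra.
  - move=> z; rewrite le_min => /andP[zr _] Fz; apply: nz; exists z => //.
    lra.
have [f fP] := choice step.
pose s := fix s n := if n is p.+1 then f (p, s p) else ((0 : V), (1 : R)).
have r0 n : 0 < (s n).2.
  by elim: n => [|n ih] //=; have [] := fP (n, s n) ih.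
have [l lP] : exists l, forall n, rnorm (l - (s n).1) <= (s n).2.
  (* Centres move by at most half the radius, hence by at most the drop of the radius: the radii
     serve as potential. *)
  apply: cvg_telescope => [n|e e0|n]; first exact: ltW.
    by apply: halving_small e0 => n; have [] := fP (n, s n) (r0 n).
  have [_ /= + + _] := fP (n, s n) (r0 n); rewrite /=; lra.
have [n Fn] := Fcov l; have [_ _ _ /(_ l)] := fP (n, s n) (r0 n).
by rewrite rnormB => /(_ (lP n.+1) Fn).
Qed.

(** * Cost relations and almost openness *)

(* [G c x] reads: the vector x can be obtained at cost c. *)
Record cost_relation {R : realType} {V : lmodType R[i]} (G : R -> V -> Prop) :
    Prop := CostRelation {
  cost0 : forall c, 0 <= c -> G c 0;
  costD : forall c d x y, G c x -> G d y -> G (c + d) (x + y);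
  costZ : forall (l : R[i]) c x, G c x -> G (complex.Re `|l| * c) (l *: x);
  cost_ge0 : forall c x, G c x -> 0 <= c
}.

Lemma cost_le {R : realType} {V : lmodType R[i]} {G : R -> V -> Prop} c d x :
  cost_relation G -> c <= d -> G c x -> G d x.
Proof.
move=> HG cd Gx; rewrite -[x]addr0 -(subrKC c d).
by apply: costD => //; apply: cost0 => //; rewrite subr_ge0.
Qed.

Lemma costZr {R : realType} {V : lmodType R[i]} {G : R -> V -> Prop} r c x :
  cost_relation G -> 0 <= r -> G c x -> G (r * c) (r%:C *: x).
Proof.
by move=> HG r0 /(costZ _ HG r%:C); rewrite ger0_norm ?ler0c.
Qed.

Lemma costB {R : realType} {V : lmodType R[i]} {G : R -> V -> Prop} c d x y :
  cost_relation G -> G c x -> G d y -> G (c + d) (x - y).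
Proof.
move=> HG Gx /(costZ _ HG (-1)); rewrite normrN1 /= mul1r scaleN1r.
exact: costD.
Qed.

(** By Baire, vectors of cost [n] are dense in some ball about [x0]. Approximating both [t x + x0]
    and [x0], subtracting and dividing by [t] moves this density to the origin. *)
Lemma cost_almost_open {R : realType} {V : completeNormedModType R[i]}
    (G : R -> V -> Prop) :
  cost_relation G -> (forall x, exists c, G c x) ->
  exists2 C : R, 0 <= C & forall (e : R) x, 0 < e ->
    exists2 z, G (C * rnorm x) z & rnorm (x - z) <= e * rnorm x.
Proof.
move=> HG Gcov.
have [|n [x0 [r r0 Fdense]]] := baire_cover (fun n => [set x | G n%:R x]).
  move=> x; have [c Gc] := Gcov x; exists (Num.truncn c).+1 => /=.
  by apply: (cost_le _ _ _ HG _ Gc); apply/ltW/truncnS_gt.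
(* The difference of two vectors of cost [n] costs [2 n], and dividing by [t = r / (2 |x|)] gives
   [4 n |x| / r]. *)
exists (n%:R * 4 / r) => [|e x e0].
  by rewrite divr_ge0 ?mulr_ge0// ltW.
have [->|x_neq0] := eqVneq x 0.
  exists 0; first by rewrite rnorm0 mulr0; apply: cost0.
  by rewrite subr0 rnorm0 mulr0.
have x_gt0 := rnorm_gt0 _ x_neq0.
have [t t0 tx] : exists2 t, 0 < t & t * rnorm x = r / 2.
  by exists (r / 2 / rnorm x); rewrite ?divfK ?gt_eqF ?divr_gt0.
have d0 : 0 < t * (e * rnorm x) / 2 by rewrite divr_gt0 ?mulr_gt0.
have [|z1 Gz1 z1P] := Fdense (t%:C *: x + x0) _ _ d0.
  by rewrite addrK rnormZr ?(ltW t0)// tx; lra.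
have [|z2 Gz2 z2P] := Fdense x0 _ _ d0; first by rewrite subrr rnorm0.
exists (t^-1%:C *: (z1 - z2)).
  rewrite (_ : _ * rnorm x = t^-1 * (n%:R + n%:R)).
    by apply: (costZr _ _ _ HG); [rewrite invr_ge0 ltW|apply: costB].
  rewrite (_ : r = t * rnorm x * 2); last by rewrite tx; field.
  by field; rewrite !gt_eqF.
rewrite -(ler_pM2l t0) -(rnormZr t) ?(ltW t0)// scalerBr scalerA -rmorphM/=.
rewrite mulfV ?gt_eqF// scale1r.
rewrite (_ : _ - _ = (t%:C *: x + x0 - z1) - (x0 - z2)).
  rewrite (le_trans (ler_rnormD _ _))// rnormN; lra.
by rewrite [_ + x0 - z1]addrAC addrKA opprB opprK addrCA addrC.
Qed.

(** * The equivalent norm attached to a cost relation *)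

Section Gauge.
Context {R : realType} {V : normedModType R[i]} (G : R -> V -> Prop) (k : R).
Hypotheses (HG : cost_relation G) (G_ge : forall c x, G c x -> rnorm x <= c).
Hypothesis k_ge1 : 1 <= k.

(** Its infimum is the infimal convolution of the cost with [k] times the norm. The second term
    keeps the gauge finite on vectors of no cost; a large [k] penalises the remainder [x - z]. *)
Definition gauge_set (x : V) : set R :=
  [set c | exists d z, G d z /\ c = d + k * rnorm (x - z)].

Definition gauge (x : V) : R := inf (gauge_set x).

Let rnorm_lb x : lbound (gauge_set x) (rnorm x).
Proof.
move=> _ [d [z [/G_ge zd ->]]].
have := ler_rnorm_dist x z 0; rewrite !subr0 => /le_trans; apply.
by rewrite addrC lerD// ler_peMl ?rnorm_ge0.
Qed.

Let gauge_le c x : gauge_set x c -> gauge x <= c.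
Proof. by move=> cx; apply: ge_inf cx; exists (rnorm x); apply: rnorm_lb. Qed.

Let gauge_set_neq0 x : gauge_set x !=set0.
Proof.
by exists (0 + k * rnorm (x - 0)), 0, 0; split=> //; apply: cost0.
Qed.

Let le_gauge c x : lbound (gauge_set x) c -> c <= gauge x.
Proof. exact: lb_le_inf. Qed.

Lemma rnorm_le_gauge x : rnorm x <= gauge x.
Proof. exact: le_gauge. Qed.

Lemma gauge_le_rnorm x : gauge x <= k * rnorm x.
Proof.
apply: gauge_le; exists 0, 0; split; first exact: cost0.
by rewrite subr0 add0r.
Qed.

Lemma gauge_le_cost c x : G c x -> gauge x <= c.
Proof.
by move=> Gx; apply: gauge_le; exists c, x; rewrite subrr rnorm0 mulr0 addr0.
Qed.

Lemma gaugeD x y : gauge (x + y) <= gauge x + gauge y.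
Proof.
rewrite -lerBlDr; apply: le_gauge => _ [c [z [Gz ->]]].
rewrite lerBlDr -lerBlDl; apply: le_gauge => _ [d [w [Gw ->]]].
rewrite lerBlDl; apply: (@le_trans _ _ (c + d + k * rnorm (x + y - (z + w)))).
  by apply: gauge_le; exists (c + d), (z + w); split => //; apply: costD.
rewrite addrACA lerD2l -mulrDr ler_pM2l ?(lt_le_trans ltr01)//.
by rewrite opprD addrACA ler_rnormD.
Qed.

Lemma gaugeZ (l : R[i]) x : gauge (l *: x) = complex.Re `|l| * gauge x.
Proof.
(* One inequality suffices: applied to [l^-1] and [l *: x] it gives the other. *)
have leZ (m : R[i]) y : m != 0 -> gauge (m *: y) <= complex.Re `|m| * gauge y.
  move=> m0; have m_gt0 : 0 < complex.Re `|m|.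
    by rewrite -ltcR RRe_real ?normr_real// normr_gt0.
  rewrite -ler_pdivrMl//; apply: le_gauge => _ [c [z [Gz ->]]].
  rewrite ler_pdivrMl// mulrDr; apply: gauge_le.
  exists (complex.Re `|m| * c), (m *: z); split; first exact: costZ.
  by rewrite -scalerBr rnormZ mulrCA.
have [->|l0] := eqVneq l 0.
  rewrite scale0r normr0 mul0r; apply/eqP; rewrite eq_le.
  rewrite (le_trans _ (rnorm_le_gauge _)) ?rnorm_ge0// andbT.
  by apply: gauge_le_cost; apply: cost0.
apply/eqP; rewrite eq_le leZ//= -[X in _ * gauge X <= _](scalerK l0).
have l_gt0 : 0 < complex.Re `|l|.
  by rewrite -ltcR RRe_real ?normr_real// normr_gt0.
rewrite -ler_pdivlMl// (le_trans (leZ _ _ _)) ?invr_eq0//.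
suff -> : complex.Re `|l^-1| = (complex.Re `|l|)^-1 by [].
apply/complexI; rewrite RRe_real ?normr_real// normfV.
by rewrite -[in LHS](RRe_real (normr_real l)) fmorphV.
Qed.

Lemma gauge_approx x (e : R) : gauge x < e ->
  exists c z, G c z /\ c + k * rnorm (x - z) < e.
Proof.
rewrite -subr_gt0 => e0.
have hi : has_inf (gauge_set x).
  by split; [exact: gauge_set_neq0|exists (rnorm x); exact: rnorm_lb].
have [_ [c [z [Gz ->]]]] := inf_adherent e0 hi.
by rewrite -/(gauge x) subrKC; exists c, z.
Qed.

(** Kept transparent so that the norm of the renormed space reduces to [gauge]. *)
Definition gauge_norm : equiv_norm V.
Proof.
apply: (EquivNorm _ _ gauge gaugeD gaugeZ).
- by exists 1 => // x; rewrite mul1r rnorm_le_gauge.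
- by exists k; [exact: lt_le_trans ltr01 _|exact: gauge_le_rnorm].
Defined.

End Gauge.

(** * Bounded maps and the projective tensor product *)

Lemma bounded_rnorm {R : realType} {E F : normedModType R[i]}
    (f : {linear E -> F}) :
  bounded_linear f <->
    exists2 M : R, 0 <= M & forall x, rnorm (f x) <= M * rnorm x.
Proof.
split=> [[M fM]|[M M0 fM]]; last first.
  by exists M%:C => x; rewrite !normr_rnorm -rmorphM/= lecR.
(* The order of [R[i]] compares real parts, so only the real part [a] of the bound matters. *)
case: M fM => a b fM; exists `|a| => // x.
have := fM x; rewrite !normr_rnorm lecE => /andP[_] /=.
rewrite mulr0 subr0 => /le_trans; apply.
by rewrite ler_wpM2r ?rnorm_ge0// ler_norm.
Qed.

(* Lifting the bilinear map p \o t to V with the norm [gauge G k] yields p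
   again by uniqueness, so gauge G k (p u) <= rnorm u. *)
Lemma ptensor_approx {R : realType} {E F T V : completeNormedModType R[i]}
    (t : {bilinear E -> F -> T}) (p : {linear T -> V}) (G : R -> V -> Prop)
    (k e : R) (u : T) :
  is_projective_tensor t -> bounded_linear p -> cost_relation G ->
  (forall c x, G c x -> rnorm x <= c) ->
  (forall a x, G (rnorm a * rnorm x) (p (t a x))) ->
  1 <= k -> 0 < e ->
  exists c z, G c z /\ c + k * rnorm (p u - z) < rnorm u + e.
Proof.
move=> ht bp HG G_ge Gt k1 e0.
suff : gauge G k (p u) <= rnorm u.
  move=> pu; apply: gauge_approx => //.
  by rewrite (le_lt_trans pu)// ltrDl.
pose Z := renormed (gauge_norm G k HG G_ge k1).
pose B : E -> F -> Z := fun a x => p (t a x).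
have B_bilinear : bilinear_for *:%R *:%R B.
  split=> [x l a b|a l x y]; rewrite /B.
    by rewrite linearPl linearP.
  by rewrite linearPr linearP.
pose B' : {bilinear E -> F -> Z} := HB.pack B
  (bilinear_isBilinear.Build _ _ _ _ _ _ B B_bilinear).
have [a x|g gB g_le] := @ptensor_lift _ _ _ _ _ ht Z B' 1 ler01.
  rewrite mul1r !normr_rnorm -rmorphM/= lecR rnorm_renormed.
  exact: gauge_le_cost.
(* The same function as [g], now into [V] with its own norm. The gauge dominates that norm, so [g']
   is bounded and uniqueness applies. *)
pose g' : {linear T -> V} := HB.pack (g : T -> V)
  (GRing.isLinear.Build _ _ _ _ (g : T -> V) (linearP g)).
have -> : p u = g' u.
  apply: (ptensor_unique ht) => //; last by move=> a x; rewrite /g'/= gB.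
  apply/bounded_rnorm; exists 1 => // w; rewrite mul1r.
  apply: le_trans (rnorm_le_gauge G k HG G_ge k1 _) _.
  by have := g_le w; rewrite mul1r !normr_rnorm lecR.
by have := g_le u; rewrite mul1r !normr_rnorm lecR.
Qed.

(** * Finite sums with additive cost, and words acting on a module *)

(** Letting the empty sum have any nonnegative cost makes the relation monotone in the cost. *)
Inductive hull {R : realType} {V : lmodType R[i]} (E : R -> V -> Prop) :
    R -> V -> Prop :=
| hull_nil c : 0 <= c -> hull E c 0
| hull_cons c d x y : E c x -> hull E d y -> hull E (c + d) (x + y).

Lemma hull_cost {R : realType} {V : lmodType R[i]} (E : R -> V -> Prop) :
  (forall c x, E c x -> 0 <= c) ->
  (forall (l : R[i]) c x, E c x -> E (complex.Re `|l| * c) (l *: x)) ->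
  cost_relation (hull E).
Proof.
move=> E_ge0 EZ.
have ge0 c x : hull E c x -> 0 <= c.
  by elim=> // {}c d {}x y /E_ge0 c0 _ d0; exact: addr_ge0.
have le c d x : hull E c x -> 0 <= d -> hull E (c + d) x.
  elim=> [{}c c0 d0|b {}c {}x y Ex _ ih d0]; first by apply: hull_nil; lra.
  by rewrite -addrA; apply: hull_cons (ih d0).
split=> //.
- exact: hull_nil.
- move=> c d x y; elim=> [{}c c0 dy|b {}c {}x z Ex _ ih dy].
    by rewrite add0r addrC; exact: le.
  by rewrite -!addrA; apply: hull_cons (ih dy).
- move=> l c x; elim=> [{}c c0|{}c d {}x y Ex _ ih].
    by rewrite scaler0; apply: hull_nil; rewrite mulr_ge0// Re_normr_ge0.
  by rewrite mulrDr scalerDr; apply: hull_cons ih; exact: EZ.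
Qed.

Lemma hull_gen {R : realType} {V : lmodType R[i]} (E : R -> V -> Prop) c x :
  E c x -> hull E c x.
Proof.
by move=> Ex; rewrite -[c]addr0 -[x]addr0; apply: hull_cons Ex (hull_nil _ _ _).
Qed.

Section Words.
Context {R : realType} {A : banachAlgType R[i]} {X : banachModType A}.
Implicit Types (s : seq A) (a : A) (x : X).

Lemma rnorm_bmul a b : rnorm (bmul a b) <= rnorm a * rnorm b.
Proof. by rewrite -lecR rmorphM/= -!normr_rnorm normr_bmul. Qed.

Lemma rnorm_bact a x : rnorm (bact a x) <= rnorm a * rnorm x.
Proof. by rewrite -lecR rmorphM/= -!normr_rnorm normr_bact. Qed.

(** The empty word is excluded because its product is the dummy 0, not a unit. *)
Lemma bact_bprod_rcons s a x : (0 < size s)%N ->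
  bact (bprod (rcons s a)) x = bact (bprod s) (bact a x).
Proof. by case: s => //= b s _; rewrite foldl_rcons bactA. Qed.

Lemma rnorm_bprod_le1 s :
  (forall a, a \in s -> `|a| <= 1) -> rnorm (bprod s) <= 1.
Proof.
have le1 a : `|a| <= 1 -> rnorm a <= 1 by rewrite normr_rnorm lecR.
elim/last_ind: s => [|s a ih] s1; first by rewrite /= rnorm0.
have a1 : rnorm a <= 1 by apply/le1/s1; rewrite mem_rcons mem_head.
case: s => [|b s] in ih s1 *; first by [].
rewrite /= foldl_rcons (le_trans (rnorm_bmul _ _))// mulr_ile1 ?rnorm_ge0//.
by apply: ih => c cs; apply: s1; rewrite mem_rcons in_cons cs orbT.
Qed.

Lemma rnorm_bprod n s : size s = n.+1 -> (forall a, a \in s -> `|a| <= 1) ->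
  rnorm (bprod s) <= nilpotency_radius A n.+1 ^+ n.+1.
Proof.
move=> /eqP sz s1; pose r := Tuple sz.
have root_le : rnorm (bprod s) `^ n.+1%:R^-1 <= nilpotency_radius A n.+1.
  (* The supremum is genuine: products of elements of the unit ball have norm at most 1. *)
  apply: ub_le_sup; last by exists r.
  exists 1 => _ [q q1 <-].
  apply: (@le_trans _ _ (1 `^ n.+1%:R^-1)); last by rewrite powR1.
  by apply: ge0_ler_powR; rewrite ?nnegrE ?rnorm_ge0// rnorm_bprod_le1.
rewrite -[leLHS]powRr1 ?rnorm_ge0// -(@mulVf _ n.+1%:R)//.
rewrite powRrM powR_mulrn ?powR_ge0//.
by rewrite lerXn2r ?nnegrE ?powR_ge0// (le_trans _ root_le) ?powR_ge0.
Qed.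

(** The cost bounds [x] before the word acts. The norm of [z] may be far smaller, and nilpotency
    exploits this gap. *)
Definition word_orbit (n : nat) (c : R) (z : X) : Prop := exists s x,
  [/\ size s = n, forall a, a \in s -> `|a| <= 1, rnorm x <= c &
      z = bact (bprod s) x].

Lemma hull_word_cost n : cost_relation (hull (word_orbit n)).
Proof.
apply: hull_cost => [c _ [s [x [_ _ + _]]]|l c _ [s [x [sn s1 xc ->]]]].
  exact: le_trans (rnorm_ge0 _).
exists s, (l *: x); split=> //; last by rewrite linearZr_LR.
by rewrite rnormZ ler_wpM2l// Re_normr_ge0.
Qed.

Lemma rnorm_hull_word n c z : hull (word_orbit n.+1) c z ->
  rnorm z <= nilpotency_radius A n.+1 ^+ n.+1 * c.
Proof.
have rad0 : 0 <= nilpotency_radius A n.+1 ^+ n.+1.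
  (* Nonnegativity is read off from the bound for the word of zeros. *)
  apply: le_trans (rnorm_bprod n (nseq n.+1 0) _ _); first exact: rnorm_ge0.
    by rewrite size_nseq.
  by move=> a /nseqP[-> _]; rewrite normr0.
elim=> [{}c c0|{}c d _ y [s [x [sn s1 xc ->]]] _ ih].
  by rewrite rnorm0 mulr_ge0.
rewrite (le_trans (ler_rnormD _ _))// mulrDr lerD//.
rewrite (le_trans (rnorm_bact _ _))// ler_pM ?rnorm_ge0//.
exact: rnorm_bprod.
Qed.

Lemma rnorm_hull_word1 c z : hull (word_orbit 1) c z -> rnorm z <= c.
Proof.
elim=> [{}c c0|{}c d _ y [s [x [_ s1 xc ->]]] _ ih]; first by rewrite rnorm0.
rewrite (le_trans (ler_rnormD _ _))// lerD//.
rewrite (le_trans (rnorm_bact _ _))// (le_trans _ xc)//.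
by rewrite ler_piMl ?rnorm_ge0// rnorm_bprod_le1.
Qed.

(** Normalise [a] to norm 1 and move the scalar [|a|] onto [x]. *)
Lemma hull_word1_bact a x : hull (word_orbit 1) (rnorm a * rnorm x) (bact a x).
Proof.
have [->|a0] := eqVneq a 0.
  by rewrite linear0l rnorm0 mul0r; apply: hull_nil.
apply: hull_gen; exists [:: `|a|^-1 *: a], (`|a| *: x); split=> //.
- by move=> b; rewrite inE => /eqP ->; rewrite normfZV.
- by rewrite rnormZ normr_id.
- by rewrite /= linearZl_LR linearZr_LR scalerA mulVf ?scale1r// normr_eq0.
Qed.

(** Each summand of [z] has a single letter, which is appended to [s]; the cost sees only the vector
    acted on and stays the same. *)
Lemma hull_word_bact n s c z : size s = n.+1 ->
  (forall a, a \in s -> `|a| <= 1) -> hull (word_orbit 1) c z ->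
  hull (word_orbit n.+2) c (bact (bprod s) z).
Proof.
move=> sn s1; elim=> [{}c c0|{}c d _ y [[|a [|b q]] [x [//= _ q1 xc ->]]] _ ih].
  by rewrite linear0r; apply: hull_nil.
rewrite linearDr; apply: hull_cons ih; exists (rcons s a), x; split=> //.
- by rewrite size_rcons sn.
- move=> b; rewrite mem_rcons inE => /predU1P[->|/s1//].
  by apply: q1; rewrite mem_head.
- by rewrite bact_bprod_rcons// sn.
Qed.

End Words.

(** * Iterating the approximation to lengthen words *)

Section Approximation.
Context {R : realType} {A : banachAlgType R[i]} {Y X : banachModType A}.
Variables (phi : {linear Y -> X}) (K C : R).
Hypothesis phi_act : forall (a : A) (y : Y), phi (bact a y) = bact a (phi y).
Hypotheses (K0 : 0 <= K) (C0 : 0 <= C).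
Hypothesis approx1 : forall (e : R) x, 0 < e -> exists y h,
  [/\ rnorm y <= K * rnorm x, hull (word_orbit 1) (C * rnorm x) h &
      rnorm (x - phi y - h) <= e * rnorm x].

(** In each summand [s . x], approximate [x] by [approx1] and let [s] act. [phi] commutes with the
    action, and words do not increase norms. *)
Lemma hull_word_approx n c z (e : R) : hull (word_orbit n.+1) c z -> 0 < e ->
  exists y h, [/\ rnorm y <= K * c, hull (word_orbit n.+2) (C * c) h &
    rnorm (z - phi y - h) <= e * c].
Proof.
move=> + e0.
elim=> [{}c c0|{}c d _ w [s [x [sn s1 xc ->]]] _ [y [h [yd hd whd]]]].
  exists 0, 0.
  rewrite rnorm0 linear0 !subr0 rnorm0 !mulr_ge0//; last exact: ltW.
  by split=> //; apply: hull_nil; rewrite mulr_ge0.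
have [y0 [h0 [y0x h0x xe]]] := approx1 e x e0.
have act_le (V : banachModType A) (v : V) : rnorm (bact (bprod s) v) <= rnorm v.
  rewrite (le_trans (rnorm_bact _ _))// ler_piMl ?rnorm_ge0//.
  exact: rnorm_bprod_le1.
exists (bact (bprod s) y0 + y), (bact (bprod s) h0 + h); split.
- rewrite mulrDr (le_trans (ler_rnormD _ _))// lerD// (le_trans (act_le _ _))//.
  by rewrite (le_trans y0x)// ler_wpM2l.
- rewrite mulrDr; apply: costD (hull_word_cost _) _ _ _ _ _ hd.
  apply: cost_le (hull_word_cost _) _ (hull_word_bact _ _ _ _ sn s1 h0x).
  by rewrite ler_wpM2l.
- have -> : bact (bprod s) x + w - phi (bact (bprod s) y0 + y) -
      (bact (bprod s) h0 + h) =
      bact (bprod s) (x - phi y0 - h0) + (w - phi y - h).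
    by rewrite !linearBr linearD phi_act !opprD (addrACA _ w) [LHS]addrACA.
  rewrite mulrDr (le_trans (ler_rnormD _ _))// lerD// (le_trans (act_le _ _))//.
  by rewrite (le_trans xe)// ler_wpM2l// ltW.
Qed.

Lemma word_approx n : exists2 Kn, 0 <= Kn & forall (e : R) x, 0 < e ->
  exists y h, [/\ rnorm y <= Kn * rnorm x,
    hull (word_orbit n.+1) (C ^+ n.+1 * rnorm x) h &
    rnorm (x - phi y - h) <= e * rnorm x].
Proof.
elim: n => [|n [Kn Kn0 ih]]; first by exists K.
(* The second approximation is applied to [h], of cost [C ^+ n.+1 * rnorm x]. *)
exists (Kn + K * C ^+ n.+1) => [|e x e0].
  by rewrite addr_ge0// mulr_ge0// exprn_ge0.
have [|y [h [yx hx xe]]] := ih (e / 2) x; first lra.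
have [|y' [h' [yx' hx' xe']]] :=
    (* The new error is relative to the cost of [h], hence the division; adding 1 keeps the divisor
       positive if [C] is 0. *)
    hull_word_approx _ _ _ (e / 2 / (C ^+ n.+1 + 1)) hx.
  by rewrite !divr_gt0// ltr_wpDl// exprn_ge0.
exists (y + y'), h'; split.
- by rewrite mulrDl (le_trans (ler_rnormD _ _))// lerD// -mulrA.
- by rewrite exprS -mulrA.
- rewrite linearD opprD addrA -(subrK h (x - phi y)) -addrA -addrA.
  rewrite (le_trans (ler_rnormD _ _))// [e]splitr mulrDl lerD//.
  rewrite addrA (le_trans xe')// mulrA ler_wpM2r ?rnorm_ge0//.
  have CP : 0 <= C ^+ n.+1 by rewrite exprn_ge0.
  by rewrite -mulrA ler_piMr ?divr_ge0 ?(ltW e0)// mulrC ler_pdivrMr; lra.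
Qed.

End Approximation.

(** * From approximate to exact surjectivity *)

Lemma almost_surjective {R : realType} {Y : completeNormedModType R[i]}
    {X : normedModType R[i]} (phi : {linear Y -> X}) (K : R) :
  bounded_linear phi -> 0 <= K ->
  (forall x, exists y, rnorm y <= K * rnorm x /\
     rnorm (x - phi y) <= rnorm x / 2) ->
  forall x, exists y, phi y = x.
Proof.
move=> /bounded_rnorm[M M0 phiM] K0 approx x.
have [f fP] := choice approx.
pose s := fix s n := if n is p.+1 then s p + f (x - phi (s p)) else 0.
pose d n := rnorm (x - phi (s n)).
have dS n : d n.+1 <= d n / 2.
  rewrite /d /= linearD opprD addrA; exact: (fP _).2.
(* As [d] halves, the increment [K * d n] is at most [2 * K * (d n - d n.+1)]. *)
have [y yP] : exists y, forall n, rnorm (y - s n) <= 2 * K * d n.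
  apply: cvg_telescope => [n|e e0|n].
  - by rewrite !mulr_ge0 ?rnorm_ge0.
  - by apply: halving_small e0 => n; rewrite -[leRHS]mulrA ler_wpM2l// mulr_ge0.
  - rewrite /= [s n + _]addrC addrK (le_trans (fP _).1)// -/(d n).
    by rewrite -mulrBr -mulrA; have := ler_wpM2l K0 (dS n); lra.
exists y; apply/eqP; rewrite eq_sym -subr_eq0; apply/eqP/rnorm_eq0/eqP.
rewrite eq_le rnorm_ge0 andbT; apply/ler_addgt0Pr => e e0; rewrite add0r.
have c0 : 0 < 1 + M * (2 * K) by rewrite ltr_pwDl// !mulr_ge0.
(* The distance from [x] to [phi y] is at most [d n + M * (2 * K * d n)]. *)
have [n dn] := halving_small d (e / (1 + M * (2 * K))) dS (divr_gt0 e0 c0).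
rewrite ltr_pdivlMr// in dn.
have phi_y : rnorm (phi (s n) - phi y) <= M * (2 * K * d n).
  by rewrite -linearB (le_trans (phiM _))// ler_wpM2l// rnormB.
have := ler_rnorm_dist x (phi (s n)) (phi y); rewrite -/(d n); lra.
Qed.

(** * The action map, and the conclusion *)

Section ActionMap.
Context {R : realType} {A : banachAlgType R[i]} {Y X : banachModType A}.
Variables (phi : {linear Y -> X}) (T : completeNormedModType R[i]).
Variables (t : {bilinear A -> X -> T}) (piX : {linear T -> X}).

Lemma cost_sum : cost_relation (fun (c : R) (x : X) =>
  exists y u, [/\ rnorm y <= c, rnorm u <= c & x = phi y + piX u]).
Proof.
split.
- by move=> c c0; exists 0, 0; rewrite !rnorm0 !linear0 addr0.
- move=> c d _ _ [y [u [yc uc ->]]] [y' [u' [yd ud ->]]].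
  exists (y + y'), (u + u'); rewrite !linearD addrACA.
  by split=> //; rewrite (le_trans (ler_rnormD _ _))// lerD.
- move=> l c _ [y [u [yc uc ->]]]; exists (l *: y), (l *: u).
  by rewrite !linearZ scalerDr !rnormZ !ler_wpM2l// Re_normr_ge0.
- by move=> c x [y [u [yc _ _]]]; apply: le_trans yc; exact: rnorm_ge0.
Qed.

Lemma word1_approx : is_projective_tensor t -> is_action_map t piX ->
  (forall x, exists y u, x = phi y + piX u) ->
  exists K C : R, [/\ 0 <= K, 0 <= C & forall (e : R) x, 0 < e -> exists y h,
    [/\ rnorm y <= K * rnorm x, hull (word_orbit 1) (C * rnorm x) h &
        rnorm (x - phi y - h) <= e * rnorm x]].
Proof.
move=> ht [pi_bounded piE] cover.
have [x|C C0 CP] := cost_almost_open _ cost_sum.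
  have [y [u ->]] := cover x; exists (Num.max (rnorm y) (rnorm u)), y, u.
  by rewrite !le_max !lexx orbT.
(* [C] bounds the tensor [u]; the extra 1 pays for the slack [rnorm x] in [ptensor_approx], positive
   once [x] is nonzero. *)
exists C, (C + 1); split=> //; first by rewrite addr_ge0.
move=> e x e0; have [->|x0] := eqVneq x 0.
  exists 0, 0; rewrite !rnorm0 !mulr0 linear0 !subr0 rnorm0; split=> //.
  exact: hull_nil.
have x_gt0 := rnorm_gt0 _ x0.
have [|z [y [u [yC uC ->]]] xz] := CP (e / 2) x; first lra.
have e2 : 0 < e / 2 by lra.
(* This [k] is so large that the bound on [k * rnorm (piX u - h)] forces the remainder below
   [e / 2 * rnorm x]. *)
have [k k1 Ck] : exists2 k, 1 <= k & (C + 1) / (e / 2) <= k.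
  exists (1 + (C + 1) / (e / 2)); last by rewrite lerDr.
  by rewrite lerDl divr_ge0 ?addr_ge0// ltW.
have [c [h [hc ck]]] := ptensor_approx t piX (hull (word_orbit 1)) k (rnorm x) u
  ht pi_bounded (hull_word_cost 1) rnorm_hull_word1
  (fun a x => eq_ind_r _ (hull_word1_bact a x) (piE a x)) k1 x_gt0.
have c0 := cost_ge0 _ (hull_word_cost 1) _ _ hc.
have cC : c + k * rnorm (piX u - h) <= (C + 1) * rnorm x.
  by rewrite mulrDl mul1r (le_trans (ltW ck))// lerD2r.
exists y, h; split=> //.
  apply: cost_le (hull_word_cost 1) _ hc; apply: le_trans cC.
  by rewrite lerDl mulr_ge0 ?rnorm_ge0// (le_trans ler01).
have uh : rnorm (piX u - h) <= e / 2 * rnorm x.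
  have : (C + 1) / (e / 2) * rnorm (piX u - h) <= (C + 1) * rnorm x.
    rewrite (le_trans _ cC)// (le_trans (ler_wpM2r (rnorm_ge0 _) Ck))//.
    by rewrite lerDr.
  rewrite -mulrA ler_pM2l ?ltr_wpDl//.
  by rewrite ler_pdivrMl.
rewrite -(subrK (piX u) (x - phi y)) -addrA (le_trans (ler_rnormD _ _))//.
by rewrite [e]splitr mulrDl lerD// -addrA -opprD.
Qed.

End ActionMap.

Theorem theorem2p2 (R : realType) (A : banachAlgType R[i])
    (hA : topologically_nilpotent A)
    (Y X : banachModType A) (phi : {linear Y -> X})
    (hphi : banach_module_morphism phi)
    (T : completeNormedModType R[i]) (t : {bilinear A -> X -> T})
    (ht : is_projective_tensor t)
    (piX : {linear T -> X}) (hpi : is_action_map t piX)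
    (hX : forall x : X, exists (y : Y) (u : T), x = phi y + piX u) :
  forall x : X, exists y : Y, phi y = x.
Proof.
have [phi_bounded phi_act] := hphi.
have [K [C [K0 C0 approx1]]] := word1_approx phi T t piX ht hpi hX.
(* Below this threshold the radius times [C] is at most 1/4, and so is its power [n.+1]. *)
have d0 : 0 < (4 * (C + 1))^-1 by rewrite invr_gt0 mulr_gt0// ltr_wpDl.
have /cvgr0Pnorm_lt/(_ _ d0)[n _ /(_ n.+1 (leqnSn n)) rad_small] := hA.
have [Kn Kn0 approx] := word_approx phi K C phi_act K0 C0 approx1 n.
apply: (almost_surjective _ _ phi_bounded Kn0) => x.
(* A quarter for this error and a quarter for [h] make the required half. *)
have [|y [h [yx hx xe]]] := approx (4^-1) x; first by rewrite invr_gt0.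
exists y; split=> //.
pose r := nilpotency_radius A n.+1.
have r_lt : `|r * C| <= 4^-1.
  rewrite normrM (ger0_norm C0) (le_trans (ler_wpM2r C0 (ltW rad_small)))//.
  by rewrite invfM -mulrA ler_piMr// mulrC ler_pdivrMr ?ltr_wpDl// mul1r lerDl.
have qn : r ^+ n.+1 * C ^+ n.+1 <= 4^-1.
  rewrite -exprMn (le_trans (ler_norm _))// normrX exprS.
  rewrite (le_trans _ r_lt)// ler_piMr// exprn_ile1// (le_trans r_lt)//.
  by rewrite invf_le1// ler1n.
rewrite -(subrK h (x - phi y)) (le_trans (ler_rnormD _ _))//.
have := rnorm_hull_word _ _ _ hx; rewrite mulrA => /le_trans hle.
have := hle _ (ler_wpM2r (rnorm_ge0 _) qn); lra.
Qed.
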